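(* For any connected graph $G$ of order $n$ and any graph $H$, $$i(G\odot H)=n\,i(H)-\beta_0(G)\,(i(H)-1).$$
   Context: All graphs are finite, undirected, without loops or multiple edges. The order of a graph is its number of vertices. For graphs $G$ and $H$, where $G$ has vertices $v_1,\dots,v_{n}$, the corona graph $G\odot H$ is obtained from one copy of $G$ and $n$ copies of $H$ by joining by an edge each vertex of the $i$-th copy of $H$ with the vertex $v_i$ of $G$. A set of vertices is independent if no two of its vertices are adjacent; $\beta_0(G)$, the independence number, is the maximum cardinality of an independent set of $G$. A set $D$ of vertices is dominating if every vertex not in $D$ has a neighbor in $D$. The independent domination number $i(G)$ is the minimum cardinality of a set that is both independent and dominating in $G$. *)

(* Defs.v *)
From mathcomp Require Import all_boot.

Set Implicit Arguments.
Unset Strict Implicit.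
Unset Printing Implicit Defensive.

Record sgraph := SGraph {
  vertex :> finType;
  adj : rel vertex;
  adj_sym : symmetric adj;
  adj_irr : irreflexive adj }.

Definition connected (G : sgraph) : Prop :=
  forall x y : G, connect (@adj G) x y.

Definition independent (G : sgraph) (S : {set G}) : bool :=
  [forall x in S, forall y in S, ~~ adj x y].

Definition dominating (G : sgraph) (D : {set G}) : bool :=
  [forall x, (x \notin D) ==> [exists y in D, adj x y]].

Definition independence_number (G : sgraph) : nat :=
  \max_(S : {set G} | independent S) #|S|.

(* A maximal independent set is dominating, so the minimum below ranges over a
   nonempty family. *)
Lemma ex_independent_dominating (G : sgraph) :
  exists k, [exists D : {set G}, [&& independent D, dominating D & #|D| == k]].
Proof.
have ind0 : independent (set0 : {set G}).
  by apply/forall_inP => x; rewrite inE.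
have [D /maxsetP[indD maxD] _] := maxset_exists ind0.
exists #|D|; apply/existsP; exists D; rewrite indD eqxx andbT /=.
apply/forallP => x; apply/implyP => xD.
apply: contraR xD => /exists_inPn noadj.
suff indxD : independent (x |: D) by rewrite -(maxD _ indxD (subsetUr _ _)) setU11.
apply/forall_inP => y /setU1P yxD; apply/forall_inP => z /setU1P zxD.
case: yxD zxD => [->|yD] [->|zD]; first by rewrite adj_irr.
- exact: noadj.
- by rewrite adj_sym; apply: noadj.
- by move/forall_inP: indD => /(_ y yD)/forall_inP/(_ z zD).
Qed.

Definition independent_domination_number (G : sgraph) : nat :=
  ex_minn (ex_independent_dominating G).

Section Corona.
Variables G H : sgraph.

(* [inl v] is the vertex [v] of [G]; [inr (v, h)] is the vertex [h] of the copy
   of [H] attached to [v]. *)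
Definition corona_adj (a b : G + G * H) : bool :=
  match a, b with
  | inl u, inl v => adj u v
  | inl u, inr (v, _) => u == v
  | inr (u, _), inl v => u == v
  | inr (u, h), inr (v, k) => (u == v) && adj h k
  end.

Lemma corona_adj_sym : symmetric corona_adj.
Proof.
by case=> [u|[u h]] [v|[v k]] //=; rewrite 1?adj_sym 1?eq_sym // adj_sym.
Qed.

Lemma corona_adj_irr : irreflexive corona_adj.
Proof. by case=> [u|[u h]] /=; rewrite adj_irr ?andbF. Qed.

Definition corona : sgraph := SGraph corona_adj_sym corona_adj_irr.

End Corona.

(* Main.v *)
(** An independent dominating set [D] of the corona meets [G] in an independent
    set [S]. Over [v \in S] the copy of [H] is disjoint from [D]; over
    [v \notin S] it can only be dominated from inside, so [D] cuts out an
    independent dominating set of [H] there. Thus the optimum is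
    [|S| + (n - |S|) i(H) = n i(H) - |S| (i(H) - 1)], which, as [i(H) >= 1], is
    smallest when [S] is a maximum independent set. *)
Require Import Defs.
From mathcomp Require Import all_boot all_order all_algebra.
From mathcomp Require Import zify.

Import GRing.Theory.
Local Open Scope ring_scope.

Lemma independentP (G : sgraph) (S : {set G}) :
  reflect {in S &, forall x y, ~~ adj x y} (independent S).
Proof.
apply: (iffP forall_inP) => [indS x y xS yS | indS x xS].
  by move/forall_inP: (indS x xS); apply.
by apply/forall_inP => y yS; apply: indS.
Qed.

Lemma dominatingP (G : sgraph) (D : {set G}) :
  reflect (forall x, x \notin D -> exists2 y, y \in D & adj x y)
          (dominating D).
Proof.
apply: (iffP forallP) => domD x.
  by move=> xD; apply/exists_inP; apply: (implyP (domD x)).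
by apply/implyP => xD; apply/exists_inP; apply: domD.
Qed.

Lemma independent_domination_number_le (G : sgraph) (D : {set G}) :
  independent D -> dominating D -> (independent_domination_number G <= #|D|)%N.
Proof.
move=> indD domD; rewrite /independent_domination_number.
case: ex_minnP => m _; apply.
by apply/existsP; exists D; rewrite indD domD eqxx.
Qed.

Lemma independent_domination_number_witness (G : sgraph) :
  exists D : {set G}, [/\ independent D, dominating D &
    #|D| = independent_domination_number G].
Proof.
rewrite /independent_domination_number.
case: ex_minnP => m /existsP[D /and3P[indD domD /eqP cardD]] _.
by exists D.
Qed.

Lemma independence_number_ge (G : sgraph) (S : {set G}) :
  independent S -> (#|S| <= independence_number G)%N.
Proof. by move=> indS; rewrite /independence_number (bigD1 S) //= leq_maxl. Qed.

Lemma independence_number_witness (G : sgraph) :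
  exists2 S : {set G}, independent S & #|S| = independence_number G.
Proof.
have ind0 : independent (set0 : {set G}).
  by apply/independentP => x y; rewrite inE.
have [|S indS eqS] := @eq_bigmax_cond _ (@independent G) (fun S => #|S|).
  (* The maximum is attained only over a nonempty family; the empty set supplies a member. *)
  by apply/card_gt0P; exists set0.
by exists S; rewrite // /independence_number eqS.
Qed.

Lemma dominating_neq0 (G : sgraph) (D : {set G}) :
  (0 < #|G|)%N -> dominating D -> exists x, x \in D.
Proof.
move=> /card_gt0P[x _] /dominatingP domD.
have [|/domD[y yD _]] := boolP (x \in D); first by exists x.
by exists y.
Qed.

Lemma independent_domination_number_gt0 (G : sgraph) :
  (0 < #|G|)%N -> (0 < independent_domination_number G)%N.
Proof.
move=> G_gt0; have [D [_ domD <-]] := independent_domination_number_witness G.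
by apply/card_gt0P; apply: dominating_neq0.
Qed.

Section Corona.
Variables G H : sgraph.
Implicit Type D : {set corona G H}.

Definition corona_base D : {set G} := [set v | inl v \in D].
Definition corona_fiber D (v : G) : {set H} := [set h | inr (v, h) \in D].

Lemma card_corona_split D :
  #|D| = (#|corona_base D| + \sum_v #|corona_fiber D v|)%N.
Proof.
rewrite -sum1_card big_mkcond big_sumType /=; congr (_ + _)%N.
  by rewrite -sum1_card [RHS]big_mkcond; apply: eq_bigr => v _; rewrite inE.
transitivity (\sum_v \sum_h (if inr (v, h) \in D then 1 else 0))%N.
  by rewrite pair_bigA; apply: eq_bigr => -[v h] _.
apply: eq_bigr => v _; rewrite -sum1_card [RHS]big_mkcond.
by apply: eq_bigr => h _; rewrite inE.
Qed.

Lemma independent_corona_base D : independent D -> independent (corona_base D).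
Proof.
move=> /independentP indD; apply/independentP => u v; rewrite !inE.
exact: indD.
Qed.

Lemma independent_corona_fiber D v :
  independent D -> independent (corona_fiber D v).
Proof.
move=> /independentP indD; apply/independentP => h k; rewrite !inE.
by move=> hD kD; have := indD _ _ hD kD; rewrite /= eqxx.
Qed.

Lemma dominating_corona_fiber D v :
  dominating D -> v \notin corona_base D -> dominating (corona_fiber D v).
Proof.
move=> /dominatingP domD; rewrite inE => vD; apply/dominatingP => h.
(* The only neighbour of [inr (v, h)] in the base is [inl v], which is outside [D]; hence the
   dominating vertex lies in the same copy of [H]. *)
rewrite inE => /domD[[u|[u k]] yD /=]; first by move/eqP=> uv; rewrite uv yD in vD.
by case/andP=> /eqP uv hk; exists k; rewrite // inE uv.
Qed.

(** Lower bound, with the subtracted terms moved across so that it lives in [nat]. Each vertex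
    outside the base of a minimum [D] carries a fiber of size at least [i(H)]. *)
Lemma independent_domination_number_corona_ge :
  (0 < #|H|)%N ->
  (#|G| * independent_domination_number H + independence_number G <=
   independent_domination_number (corona G H) +
     independence_number G * independent_domination_number H)%N.
Proof.
move=> /independent_domination_number_gt0 i_gt0.
have [D [indD domD <-]] := independent_domination_number_witness (corona G H).
set i := independent_domination_number H in i_gt0 *.
have leSb := independence_number_ge _ _ (independent_corona_base _ indD).
have fiber_ge : (#|~: corona_base D| * i <= \sum_v #|corona_fiber D v|)%N.
  (* Fibers over the base are bounded below by 0, so both sums range over all of [G]. *)
  rewrite -sum_nat_const [leqLHS]big_mkcond; apply: leq_sum => v _.
  rewrite in_setC; case: ifP => // vD; apply: independent_domination_number_le.
    exact: independent_corona_fiber.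
  exact: dominating_corona_fiber _ _ domD vD.
rewrite card_corona_split -(cardsC (corona_base D)).
(* With [b] the independence number and [S] the base, what remains is [(b - #|S|) * (i - 1) >= 0],
   from [leSb] and [i_gt0]. *)
nia.
Qed.

(** The candidate for the upper bound. Leaving the copies over [S] empty avoids the edges between a
    vertex of [S] and its own copy. *)
Definition corona_set (S : {set G}) (E : {set H}) : {set corona G H} :=
  [set x : G + G * H |
    match x with inl v => v \in S | inr (v, h) => (v \notin S) && (h \in E) end].

Lemma independent_corona_set S E :
  independent S -> independent E -> independent (corona_set S E).
Proof.
move=> /independentP indS /independentP indE; apply/independentP.
case=> [u|[u h]] [v|[v k]]; rewrite !inE /=.
- exact: indS.
- by move=> uS /andP[vS _]; apply: contraNneq vS => <-.
- by move=> /andP[uS _] vS; apply: contraNneq uS => ->.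
- by move=> /andP[_ hE] /andP[_ kE]; rewrite negb_and indE ?orbT.
Qed.

Lemma dominating_corona_set S E :
  (0 < #|H|)%N -> dominating E -> dominating (corona_set S E).
Proof.
(* A base vertex outside [S] is dominated by the element [e] of its own copy of [E]. *)
move=> H_gt0 domE; have [e eE] := dominating_neq0 _ _ H_gt0 domE.
apply/dominatingP => -[v|[v h]]; rewrite inE /=.
  by move=> vS; exists (inr (v, e)); rewrite ?inE /= ?vS ?eE ?eqxx.
have [vS _|vS hE] := boolP (v \in S).
  by exists (inl v); rewrite ?inE /= ?eqxx.
move/dominatingP: domE => /(_ h hE)[k kE hk].
by exists (inr (v, k)); rewrite ?inE /= ?vS ?kE ?eqxx.
Qed.

Lemma card_corona_set S E :
  #|corona_set S E| = (#|S| + #|~: S| * #|E|)%N.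
Proof.
rewrite card_corona_split -sum_nat_const [in RHS]big_mkcond; congr (_ + _)%N.
  by apply: eq_card => v; rewrite !inE.
apply: eq_bigr => v _; rewrite inE; case: ifP => vS.
  by apply: eq_card => h; rewrite !inE vS.
by apply: eq_card0 => h; rewrite !inE vS.
Qed.

End Corona.

(** For empty [H] the formula would read [i(G) = b], with [b] the independence number of [G], which
    fails for stars with at least two leaves; hence [hH]. *)
Theorem theorem17 (G H : sgraph) (n : nat)
    (hG : connected G) (hn : #|G| = n) (hH : (0 < #|H|)%N) :
  (independent_domination_number (corona G H))%:Z =
    n%:Z * (independent_domination_number H)%:Z
    - (independence_number G)%:Z * ((independent_domination_number H)%:Z - 1).
Proof.
have ge_i := independent_domination_number_corona_ge G H hH.
have [S indS cardS] := independence_number_witness G.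
have [E [indE domE cardE]] := independent_domination_number_witness H.
(* A maximum independent [S] and a minimum independent dominating [E] give the bound matching
   [ge_i]. *)
have le_i := independent_domination_number_le _ _
  (independent_corona_set _ _ _ _ indS indE)
  (dominating_corona_set _ _ S _ hH domE).
rewrite card_corona_set cardS cardE in le_i.
have := cardsC S; rewrite hn cardS => card_n.
rewrite hn in ge_i; nia.
Qed.
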